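(* Let $G$ be a modular abelian independence group and let $X,Y$ be nonempty finite-rank subsets of $G$. Then: (i) We have $$\rho(XY)\geq\min\bigl\{\mu(G),\rho(X)+\rho(Y)-1\bigr\},$$ where $\mu(G)$ is the submonoid-rank threshold of $G$. (ii) There is a nonempty flat $S\subseteq\operatorname{cl}(XY)$ and a finite-rank flat submonoid $M$ of $G$ such that $SM=S$ and $$\rho(X)+\rho(Y)-\rho(S)\leq\rho(M)\leq\rho(S)\leq\rho(XY).$$ Consequently, if $$\rho(XY)<\rho(X)+\rho(Y)-1,$$ then $\rho(M)>1$.
   Context: A finitary matroid is a pair $(E,\mathcal{I})$ consisting of a set $E$ and a nonempty collection $\mathcal{I}$ of subsets of $E$ (called the independent sets) such that: (I1) if $A\in\mathcal{I}$ and $B\subseteq A$ then $B\in\mathcal{I}$; (I2) if $A,B$ are finite elements of $\mathcal{I}$ with $|B|=|A|+1$, then there is $x\in B\setminus A$ with $\{x\}\cup A\in\mathcal{I}$; (I3) if $A\subseteq E$ and every finite subset of $A$ belongs to $\mathcal{I}$, then $A\in\mathcal{I}$. The collection $\mathcal{I}$ is called an independence structure on $E$. A basis of a subset $A\subseteq E$ is an inclusion-maximal independent subset of $A$; any two bases of $A$ have the same cardinality, and the rank $\rho(A)$ is that cardinal number; $A$ has finite rank, written $\rho(A)<\infty$, if $\rho(A)$ is a nonnegative integer. An element $x\in E$ depends on $A\subseteq E$ if either $x\in A$, or $x\notin A$ and $\{x\}\cup B\notin\mathcal{I}$ for some independent $B\subseteq A$. The closure is $\operatorname{cl}(A)=\{x\in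 E: x\text{ depends on }A\}$, and $A$ is a flat if $\operatorname{cl}(A)=A$. The finitary matroid is modular if $\rho(A)+\rho(B)=\rho(A\cup B)+\rho(A\cap B)$ (as cardinals) for all flats $A,B$. An independence group is a group $G$ (written multiplicatively, with identity $1$) together with an independence structure $\mathcal{I}$ on the set $G$ such that for every $g\in G$ and $A\subseteq G$ one has $gA\in\mathcal{I}$ if and only if $A\in\mathcal{I}$, where $gA=\{gx:x\in A\}$. A modular abelian independence group is an independence group that is modular as a finitary matroid and whose group is abelian. For $X,Y\subseteq G$, $XY=\{xy:x\in X,y\in Y\}$. A submonoid of $G$ is a subset containing $1$ and closed under multiplication; a flat submonoid is a submonoid that is also a flat. The submonoid-rank threshold of $G$ is $$\mu(G)=\min\Bigl(\bigl\{\rho(H):H\text{ is a submonoid of }G\text{ and }1<\rho(H)<\infty\bigr\}\cup\{\infty\}\Bigr).$$ *)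

(* Defs.v *)
From mathcomp Require Import all_boot all_order all_algebra.
From mathcomp Require Import finmap.
From mathcomp Require Import mathcomp_extra boolp classical_sets functions
  cardinality constructive_ereal.

Set Implicit Arguments.
Unset Strict Implicit.
Unset Printing Implicit Defensive.

Import Order.TTheory GRing.Theory Num.Theory.

Local Open Scope classical_set_scope.
Local Open Scope card_scope.

Section FinitaryMatroid.
Context {E : choiceType}.
Implicit Types (I : set (set E)) (A B : set E).

Record finitary_matroid I : Prop := FinitaryMatroid {
  fm_nonempty : I !=set0 ;
  fm_subset : forall A B, I A -> B `<=` A -> I B ;
  fm_exchange : forall (n : nat) A B, I A -> I B ->
    A #= `I_n -> B #= `I_n.+1 -> exists2 x, (B `\` A) x & I (x |` A) ;
  fm_finitary : forall A,
    (forall F, finite_set F -> F `<=` A -> I F) -> I A }.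

Definition basis I A B : Prop :=
  [/\ I B, B `<=` A & forall C, I C -> C `<=` A -> B `<=` C -> C = B].

(* The cardinal rho(A), represented by a chosen basis of A; as all bases of A
   are equinumerous, it is meaningful up to [#=]. *)
Definition card_rank I A : set E := xget set0 (basis I A).

Definition finite_rank I A : Prop := finite_set (card_rank I A).

(* rho(A) with all infinite cardinals identified to +oo.  The values are taken
   in [\bar int] rather than in an extension of [nat] so that the subtractions
   in rho(X) + rho(Y) - 1 and rho(X) + rho(Y) - rho(S) are not truncated. *)
Definition rank I A : \bar int :=
  if `[< finite_rank I A >] then
    ((#|` fset_set (card_rank I A)|)%fset%:Z)%:E%E
  else +oo%E.

Definition depends I (x : E) A : Prop :=
  A x \/ (~ A x /\ exists B, [/\ I B, B `<=` A & ~ I (x |` B)]).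

Definition cl I A : set E := [set x | depends I x A].

Definition flat I A : Prop := cl I A = A.

(* A sum of two cardinals is the cardinal of a disjoint union. *)
Definition card_sum A B : set (E + E) := (inl @` A) `|` (inr @` B).

(* An equality of possibly infinite cardinals, hence [card_rank], not [rank]. *)
Definition modular I : Prop := forall A B, flat I A -> flat I B ->
  card_sum (card_rank I A) (card_rank I B) #=
  card_sum (card_rank I (A `|` B)) (card_rank I (A `&` B)).

End FinitaryMatroid.

Section IndependenceGroup.
Context {G : groupType}.
Implicit Types (I : set (set G)) (X Y H : set G).
Local Open Scope group_scope.

Definition set_prod X Y : set G := [set x * y | x in X & y in Y].

Definition independence_group I : Prop :=
  finitary_matroid I /\
  forall (g : G) (A : set G), I [set g * x | x in A] <-> I A.

Definition modular_abelian_independence_group I : Prop :=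
  [/\ independence_group I, modular I & forall x y : G, x * y = y * x].

Definition submonoid H : Prop :=
  H 1 /\ forall x y, H x -> H y -> H (x * y).

Definition threshold_set I : set (\bar int) :=
  [set rank I H | H in [set H | submonoid H /\
                                (1 < rank I H < +oo)%E]] `|` [set +oo%E].

(* The least element of [threshold_set I]: it exists because every element is
   either an integer > 1 or +oo. *)
Definition mu I : \bar int :=
  xget +oo%E (threshold_set I `&` lbound (threshold_set I)).

End IndependenceGroup.

(* Main.v *)
Require Import Defs.
From mathcomp Require Import all_boot all_order all_algebra.
From mathcomp Require Import boolp classical_sets cardinality constructive_ereal.
From mathcomp Require Import finmap zify.

(** The argument is the additive-combinatorial Dyson transform, carried out in
    the lattice of finite-rank flats.  After translating X and Y by mutually
    inverse elements, which changes neither X Y nor the ranks, one may assume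
    1 \in Y, and both sets may be replaced by their closures since
    cl X cl Y is contained in cl (X Y) ([set_prod_cl]).

    Call a pair of flats saturated when X Y is contained in X.  If (X, Y) is
    not saturated, some e in X has e Y not contained in X, and one passes to
    X1 = cl (X \cup e Y) and Y1 = Y \cap e^-1 X.  Commutativity gives
    X1 Y1 inside cl (X Y): an element e y of e Y times an element e^-1 x of
    e^-1 X is x y.  Modularity applied to the flats X and e Y says that the sum
    of the ranks is unchanged, while the rank of the first set strictly
    increases because X is a flat; so the rank of the second strictly
    decreases and the process stops ([dyson_saturation]).

    At a saturated pair (S, N), the submonoid M of all g with S g inside S
    contains N, hence rho(M) >= rho(N) = rho(X) + rho(Y) - rho(S).  It is a
    flat because translations preserve closures, and s M is contained in S for
    any s in S, hence rho(M) <= rho(S).  This is the second part.  For the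
    first, if rho(X Y) < rho(X) + rho(Y) - 1, then 1 < rho(M) < oo, so that
    rho(M), which is at most rho(X Y), bounds the threshold ([mu_lbound]).

    What this needs of matroid theory is that rank and closure behave as usual
    on sets of finite rank: bases exist by Zorn's lemma and finitarity
    ([indep_extend]), and a basis of a set is a basis of its closure
    ([cl_basis]). *)

Set Implicit Arguments.
Unset Strict Implicit.
Unset Printing Implicit Defensive.

Import Order.TTheory.

Local Open Scope classical_set_scope.
Local Open Scope card_scope.

(** * Finite cardinals *)

Definition fcard {T : choiceType} (A : set T) : nat := #|` fset_set A|%fset.

Section FiniteCardinals.
Context {T : choiceType}.
Implicit Types A B : set T.

Lemma fcardP A : finite_set A -> A #= `I_(fcard A).
Proof. by case=> n An; rewrite /fcard (card_fset_set An). Qed.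

Lemma fcardU1 x A : finite_set A -> ~ A x -> fcard (x |` A) = (fcard A).+1.
Proof.
move=> fA nAx; rewrite /fcard fset_setU1// cardfsU1 in_fset_set//.
by case: (boolP (x \in A)) => [/set_mem|].
Qed.

Lemma finite_card_leN A n : ~ (`I_n.+1 #<= A) ->
  finite_set A /\ (fcard A <= n)%N.
Proof.
move=> nA; have fA : finite_set A.
  apply: contrapT => /infiniteP/(card_le_trans _) h; apply: nA.
  exact/h/card_leT.
split=> //; rewrite leqNgt; apply/negP => lt; apply: nA.
by rewrite (card_le_eqr (fcardP fA)) card_le_II.
Qed.

End FiniteCardinals.

Lemma card_eq_fcard {T U : choiceType} (A : set T) (B : set U) :
  finite_set B -> A #= B -> fcard A = fcard B.
Proof.
by move=> fB AB; apply: card_fset_set (card_eq_trans AB (fcardP fB)).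
Qed.

Lemma fcard_card_sum {T : choiceType} (A B : set T) :
  finite_set A -> finite_set B ->
  finite_set (Defs.card_sum A B) /\
  fcard (Defs.card_sum A B) = (fcard A + fcard B)%N.
Proof.
move=> fA fB; have fA' := finite_image (@inl T T) fA.
have fB' := finite_image (@inr T T) fB.
rewrite /Defs.card_sum; split; first by rewrite finite_setU.
rewrite /fcard fset_setU// cardfsU -fset_setI//.
suff -> : (inl @` A `&` inr @` B : set (T + T)) = set0.
  rewrite fset_set0 cardfs0 subn0 !fset_set_image// !card_imfset//.
    by move=> x y [].
  by move=> x y [].
by apply/seteqP; split=> // z [[x _ <-] [y _]].
Qed.

Lemma finite_card_sumP {T : choiceType} (A B : set T) :
  finite_set (Defs.card_sum A B) -> finite_set A /\ finite_set B.
Proof.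
rewrite finite_setU => -[fA fB]; split.
  suff /eq_finite_set <- : (inl @` A : set (T + T)) #= A by [].
  by apply: inj_card_eq => x y _ _ [].
suff /eq_finite_set <- : (inr @` B : set (T + T)) #= B by [].
by apply: inj_card_eq => x y _ _ [].
Qed.

(** * Rank and closure in finitary matroids *)

(** Meaningful for sets of finite rank only: the size of an infinite basis is
    sent to 0. *)
Definition rk {E : choiceType} (I : set (set E)) (A : set E) : nat :=
  fcard (card_rank I A).

Section Rank.
Context {E : choiceType} {I : set (set E)} (fmI : finitary_matroid I).
Implicit Types A B C D : set E.

Lemma rankE A : finite_rank I A -> rank I A = ((rk I A)%:Z)%:E%E.
Proof. by move=> fA; rewrite /rank asboolT. Qed.

(** The exchange axiom for any gap in size, with D possibly infinite: a subset
    of D with exactly one element more than A is extracted first. *)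
Lemma exchange A D : finite_set A -> I A -> I D -> `I_(fcard A).+1 #<= D ->
  exists x, [/\ D x, ~ A x & I (x |` A)].
Proof.
move=> fA IA ID /card_subP[D' cD' D'D].
have [x [D'x nAx] IxA] := fm_exchange fmI IA (fm_subset fmI ID D'D)
  (fcardP fA) cD'.
by exists x; split=> //; exact: D'D.
Qed.

(** Zorn's lemma on the sets B such that C `|` B is independent and contained in
    A.  Adding C inside the predicate makes the empty chain harmless.  The
    union of a chain stays independent because a finite part of it already lies
    in one member, so finitarity applies. *)
Lemma indep_extend A C : I C -> C `<=` A ->
  exists2 B, basis I A B & C `<=` B.
Proof.
move=> IC CA.
pose P B := I (C `|` B) /\ C `|` B `<=` A.
have [F FP Ftot|B [[IB BA] Bmax]] := @Zorn_bigcup _ P.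
  have [[B0 FB0]|F0] := pselect (F !=set0); last first.
    suff -> : \bigcup_(X in F) X = set0 by rewrite /P setU0.
    by apply/seteqP; split=> // x [X FX _]; apply: F0; exists X.
  split; last first.
    move=> x [/CA//|[X FX Xx]]; have [_ +] := FP _ FX; apply; by right.
  apply: (fm_finitary fmI) => K fK KF.
  (* A finite part of the union of a nonempty chain lies in one member. *)
  suff [X FX KX] : exists2 X, F X & K `<=` C `|` X.
    by have [IX _] := FP _ FX; exact (fm_subset fmI IX KX).
  have [s Ks] := (finite_seqP K).1 fK.
  rewrite {K fK}Ks in KF *; elim: s KF => [_|a s IH KF].
    by exists B0.
  have [x xs|X FX sX] := IH; first by apply: KF => /=; rewrite inE xs orbT.
  have [Ca|[Y FY Ya]] := KF a (mem_head _ _).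
    by exists X => // x /=; rewrite inE => /predU1P[->|/sX//]; left.
  have [XY|YX] := Ftot _ _ FX FY.
    exists Y => // x /=; rewrite inE => /predU1P[->|/sX[|/XY]]; by [right|left].
  exists X => // x /=; rewrite inE => /predU1P[->|/sX//]; right; exact: YX.
exists (C `|` B); last by left.
split=> // D ID DA CBD.
apply: contrapT => DCB; apply: (Bmax D); last first.
  have CD : C `<=` D by move=> x Cx; apply: CBD; left.
  by rewrite /P ((setUidPr _ _).2 CD).
split; first by move=> x Bx; apply: CBD; right.
move=> DB; apply: DCB; apply/seteqP; split=> // x /DB; by right.
Qed.

Lemma indep0 : I set0.
Proof. by have [B IB] := fm_nonempty fmI; exact: (fm_subset fmI IB). Qed.

Lemma card_rankP A : basis I A (card_rank I A).
Proof.
apply: xgetPex; have [B BA _] := indep_extend indep0 (sub0set A).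
by exists B.
Qed.

Lemma basis_augment A B x : basis I A B -> A x -> ~ B x -> ~ I (x |` B).
Proof.
move=> [_ BA Bmax] Ax nBx IxB; apply: nBx.
rewrite -(Bmax _ IxB) //; first by left.
by move=> y [->|/BA].
Qed.

Lemma basis_bound A B D : basis I A B -> finite_set B -> I D -> D `<=` A ->
  finite_set D /\ (fcard D <= fcard B)%N.
Proof.
move=> bB fB ID DA; apply: finite_card_leN => /(exchange fB).
case: (bB) => IB BA _ /(_ IB ID)[x [/DA Ax nBx]].
exact: basis_augment bB Ax nBx.
Qed.

Lemma indep_bound A D : finite_rank I A -> I D -> D `<=` A ->
  finite_set D /\ (fcard D <= rk I A)%N.
Proof. by move=> fA; exact: basis_bound (card_rankP A) fA. Qed.

Lemma basis_rank A B : basis I A B -> finite_set B ->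
  finite_rank I A /\ rk I A = fcard B.
Proof.
move=> bB fB; have [IC CA _] := card_rankP A.
have [fC leCB] := basis_bound bB fB IC CA.
have [IB BA _] := bB; have [_ leBC] := indep_bound fC IB BA.
by split=> //; apply/eqP; rewrite eqn_leq leCB.
Qed.

Lemma basis_finite A B : basis I A B -> finite_rank I A -> finite_set B.
Proof. by move=> [IB BA _] fA; have [] := indep_bound fA IB BA. Qed.

Lemma sub_rank A C : finite_rank I C -> A `<=` C ->
  finite_rank I A /\ (rk I A <= rk I C)%N.
Proof.
move=> fC sAC; have [IB BA _] := card_rankP A.
apply: (indep_bound fC IB); exact: subset_trans sAC.
Qed.

Lemma finite_finite_rank A : finite_set A -> finite_rank I A.
Proof.
by move=> fA; have [_ BA _] := card_rankP A; exact: sub_finite_set fA.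
Qed.

(** This is the step where the definition of dependence, which lets the
    dependent set x |` C come from any independent C in A, is reduced to a
    single basis.  If x |` B were independent for a basis B of A, then,
    extending C to a basis C' of the same size as B, exchange would add to C'
    an element of x |` B: an element of B contradicts the maximality of C', and
    x itself contradicts the dependence of x |` C. *)
Lemma cl_basis A B : finite_rank I A -> basis I A B -> basis I (cl I A) B.
Proof.
move=> fA bB; have [IB BA _] := bB.
have fB := basis_finite bB fA; have [_ rB] := basis_rank bB fB.
split=> //; first by move=> x /BA; left.
move=> D ID DclA BD; apply/seteqP; split=> // x Dx; apply: contrapT => nBx.
have IxB : I (x |` B) by apply: (fm_subset fmI ID) => y [->|/BD].
have [Ax|[nAx [C [IC CA nIxC]]]] := DclA _ Dx.
  exact: basis_augment bB Ax nBx IxB.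
have [C' bC' CC'] := indep_extend IC CA; have [IC' C'A _] := bC'.
have fC' := basis_finite bC' fA; have [_ rC'] := basis_rank bC' fC'.
have [|y [yxB nC'y IyC']] := exchange fC' IC' IxB.
  rewrite -rC' rB -(fcardU1 fB nBx) (card_le_eqr (fcardP _)) ?card_le_II//.
  by rewrite finite_setU.
case: yxB => [yx|/BA Ay]; last exact: basis_augment bC' Ay nC'y IyC'.
by apply: nIxC; apply: (fm_subset fmI IyC') => z [->|/CC']; [left|right].
Qed.

Lemma sub_cl A : A `<=` cl I A.
Proof. by move=> x; left. Qed.

Lemma cl_mono A C : A `<=` C -> cl I A `<=` cl I C.
Proof.
move=> sAC x [/sAC|[nAx [B [IB BA nI]]]]; first by left.
have [|nCx] := pselect (C x); first by left.
by right; split=> //; exists B; split=> // y /BA/sAC.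
Qed.

Lemma cl_rank A : finite_rank I A ->
  finite_rank I (cl I A) /\ rk I (cl I A) = rk I A.
Proof.
move=> fA; have bA := card_rankP A.
exact: (basis_rank (cl_basis fA bA)).
Qed.

(** A basis of A has the full rank of C, so no element of C extends it. *)
Lemma sub_cl_of_rank A C :
  finite_rank I C -> A `<=` C -> (rk I C <= rk I A)%N -> C `<=` cl I A.
Proof.
move=> fC sAC leCA x Cx; have [fA _] := sub_rank fC sAC.
have [IB BA _] := card_rankP A.
have [|nAx] := pselect (A x); first by left.
right; split=> //; exists (card_rank I A); split=> // IxB.
have [|_] := indep_bound fC IxB; first by move=> y [->//|/BA/sAC].
by rewrite fcardU1 => [||/BA//]//; rewrite ltnNge leCA.
Qed.

(** Taking the closure twice does not raise the rank, so equality of ranks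
    forces cl (cl A) back into cl A. *)
Lemma cl_flat A : finite_rank I A -> flat I (cl I A).
Proof.
move=> fA; have [fcA rcA] := cl_rank fA; have [fccA rccA] := cl_rank fcA.
apply/seteqP; split; last exact: sub_cl.
apply: sub_cl_of_rank => //; last by rewrite rccA rcA.
exact/(subset_trans (@sub_cl _))/sub_cl.
Qed.

Lemma cl_sub_flat A C : flat I C -> A `<=` C -> cl I A `<=` C.
Proof. by move=> fC /cl_mono; rewrite fC. Qed.

Lemma flat_setI A C : flat I A -> flat I C -> flat I (A `&` C).
Proof.
move=> fA fC; apply/seteqP; split; last exact: sub_cl.
by rewrite subsetI; split; apply: cl_sub_flat.
Qed.

(** Modularity is an equality of cardinals of disjoint unions; finiteness of
    the left side is what makes the union of two finite-rank flats of finite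
    rank. *)
Lemma modular_rank A C : modular I -> flat I A -> flat I C ->
  finite_rank I A -> finite_rank I C ->
  finite_rank I (A `|` C) /\
  (rk I A + rk I C = rk I (A `|` C) + rk I (A `&` C))%N.
Proof.
move=> mI flA flC fA fC; have eqc := mI _ _ flA flC.
have [fs es] := fcard_card_sum fA fC.
have fs' := fs; rewrite (eq_finite_set eqc) in fs'.
have [fU fI] := finite_card_sumP fs'; split=> //.
by have [_ <-] := fcard_card_sum fU fI; rewrite -es; exact: card_eq_fcard.
Qed.

End Rank.

(** * Translation and stabilizers *)

Section Translation.
Context {G : groupType} {I : set (set G)} (hG : independence_group I).
Implicit Types (A B X Y S : set G) (g : G).
Local Open Scope group_scope.

Let fmI : finitary_matroid I := hG.1.

Definition translate g A : set G := [set g * x | x in A].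

Lemma translateE g A x : translate g A (g * x) = A x.
Proof. by apply/propext; split=> [[y Ay /mulgI <-]//|]; exists x. Qed.

Lemma translateK g A : translate g^-1 (translate g A) = A.
Proof.
apply/seteqP; split=> x; first by case=> _ [y Ay <-] <-; rewrite mulKg.
by rewrite -[x in _ -> _ x](mulKg g) translateE translateE.
Qed.

Lemma translateVK g A : translate g (translate g^-1 A) = A.
Proof. by rewrite -{1}(invgK g) translateK. Qed.

Lemma cl_translate g A x : cl I A x -> cl I (translate g A) (g * x).
Proof.
case=> [Ax|[nAx [B [IB BA nI]]]]; first by left; rewrite translateE.
right; split; first by rewrite translateE.
exists (translate g B); split; first exact/hG.2.
  exact: image_subset.
move=> IgxB; apply: nI; apply/(hG.2 g).
by rewrite image_setU image_set1.
Qed.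

Lemma flat_translate g A : flat I A -> flat I (translate g A).
Proof.
move=> flA; apply/seteqP; split; last exact: sub_cl.
move=> x /(cl_translate g^-1); rewrite translateK flA -(translateE g).
by rewrite mulVKg.
Qed.

Lemma basis_translate g A B :
  basis I A B -> basis I (translate g A) (translate g B).
Proof.
move=> [IB BA Bmax]; split; [exact/hG.2 | exact: image_subset |].
move=> D ID DgA gBD; rewrite -[D](translateVK g); congr translate.
apply: Bmax; first exact/hG.2.
  by rewrite -(translateK g A); exact: image_subset.
by rewrite -(translateK g B); exact: image_subset.
Qed.

Lemma rank_translate g A : finite_rank I A ->
  finite_rank I (translate g A) /\ rk I (translate g A) = rk I A.
Proof.
move=> fA; have bA := card_rankP fmI A.
have fgB : finite_set (translate g (card_rank I A)) by exact: finite_image.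
have [fgA ->] := basis_rank fmI (basis_translate g bA) fgB; split=> //.
by apply: card_eq_fcard => //; apply: inj_card_eq => x y _ _ /mulgI.
Qed.

Lemma set_prod_clr X Y : set_prod X (cl I Y) `<=` cl I (set_prod X Y).
Proof.
move=> _ [x Xx [y cYy <-]]; apply: cl_mono (cl_translate x cYy).
by move=> _ [z Yz <-]; exists x => //; exists z.
Qed.

(** Only S g inside S is required, not equality, so this is a submonoid and in
    general not a subgroup. *)
Definition stabilizer S : set G := [set g | forall s, S s -> S (s * g)].

Lemma stabilizer_submonoid S : submonoid (stabilizer S).
Proof.
split=> [s|x y Sx Sy s Ss]; first by rewrite mulg1.
by rewrite mulgA; exact/Sy/Sx.
Qed.

Lemma set_prod_stabilizer S : set_prod S (stabilizer S) = S.
Proof.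
apply/seteqP; split=> [_ [s Ss [g Sg <-]]|s Ss]; first exact: Sg.
exists s => //; exists 1; last exact: mulg1.
by have [] := stabilizer_submonoid S.
Qed.

(** The stabilizer is the intersection of the flats s^-1 S for s in S. *)
Lemma stabilizer_flat S : flat I S -> flat I (stabilizer S).
Proof.
move=> flS; apply/seteqP; split; last exact: sub_cl.
move=> g cg s Ss; apply: (cl_sub_flat flS _ (cl_translate s cg)).
by move=> _ [h Sh <-]; exact: Sh.
Qed.

(** Any s in S embeds the stabilizer into s^-1 S. *)
Lemma stabilizer_rank S : S !=set0 -> finite_rank I S ->
  finite_rank I (stabilizer S) /\ (rk I (stabilizer S) <= rk I S)%N.
Proof.
move=> [s Ss] fS; have [fsS <-] := rank_translate s^-1 fS.
apply: (sub_rank fmI fsS) => g Sg; exists (s * g); first exact: Sg.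
exact: mulKg.
Qed.

End Translation.

(** * Products of finite-rank sets and the Dyson transform *)

Section AbelianProduct.
Context {G : groupType} {I : set (set G)}.
Context (hG : modular_abelian_independence_group I).
Implicit Types (A B X Y S N : set G).
Local Open Scope group_scope.

Let hI : independence_group I. Proof. by case: hG. Qed.
Let fmI : finitary_matroid I := hI.1.
Let mulgC (x y : G) : x * y = y * x. Proof. by case: hG. Qed.

Lemma set_prodC X Y : set_prod X Y = set_prod Y X.
Proof.
apply/seteqP; split=> _ [x Xx [y Yy <-]];
  by exists y => //; exists x => //; rewrite mulgC.
Qed.

Lemma set_prod_cll X Y : set_prod (cl I X) Y `<=` cl I (set_prod X Y).
Proof. by rewrite ![set_prod _ Y]set_prodC; exact: set_prod_clr. Qed.

Lemma set_prod_cl X Y : finite_rank I (set_prod X Y) ->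
  set_prod (cl I X) (cl I Y) `<=` cl I (set_prod X Y).
Proof.
move=> fXY; apply: subset_trans (@set_prod_cll _ _) _.
apply: (cl_sub_flat (cl_flat fmI fXY)); exact: set_prod_clr.
Qed.

Lemma set_prod_mono A B X Y :
  A `<=` X -> B `<=` Y -> set_prod A B `<=` set_prod X Y.
Proof.
move=> AX BY _ [a Aa [b Bb <-]].
by exists a; [exact: AX | exists b => //; exact: BY].
Qed.

(** With finite bases B of X and C of Y, the product X Y lies in
    cl B cl C, hence in the closure of the finite set B C. *)
Lemma finite_rank_prod X Y : finite_rank I X -> finite_rank I Y ->
  finite_rank I (set_prod X Y).
Proof.
have gen A : finite_rank I A -> A `<=` cl I (card_rank I A).
  move=> fA; have [IB BA Bmax] := card_rankP fmI A.
  apply: (sub_cl_of_rank fmI fA BA).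
  have [|_ ->//] := @basis_rank _ _ fmI (card_rank I A) (card_rank I A) _ fA.
  split=> // C _ CB BC; exact/seteqP.
move=> fX fY; set B := card_rank I X; set C := card_rank I Y.
have fBC : finite_rank I (set_prod B C).
  by apply: (finite_finite_rank fmI); exact: finite_image2.
have [fcBC _] := cl_rank fmI fBC.
have [] // := sub_rank fmI fcBC (A := set_prod X Y).
exact: subset_trans (set_prod_mono (gen _ fX) (gen _ fY)) (set_prod_cl fBC).
Qed.

(** Induction on the rank of Y.  While X Y is not contained in X, replacing
    (X, Y) by (cl (X `|` e Y), Y `&` e^-1 X) for a suitable e in X keeps 1 in
    the second set, keeps the product inside cl (X Y) and the sum of the ranks
    constant, and lowers the rank of the second set. *)
Lemma dyson_saturation n X Y :
  flat I X -> flat I Y -> finite_rank I X -> finite_rank I Y -> Y 1 ->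
  (rk I Y < n)%N ->
  exists S N,
    [/\ flat I S, finite_rank I S & X `<=` S] /\
    [/\ N 1, set_prod S N `<=` cl I (set_prod X Y), set_prod S N `<=` S &
      (rk I S + rk I N = rk I X + rk I Y)%N].
Proof.
elim: n X Y => [//|n IH] X Y flX flY fX fY Y1 ltYn.
have [XYX|/existsNP[_ /not_implyP[[e Xe [y Yy <-]] nXey]]] :=
  pselect (set_prod X Y `<=` X).
  by exists X, Y; split; split=> //; exact: sub_cl.
have flY' := flat_translate hI e flY.
have [fY' rY'] := rank_translate hI e fY.
have [_ mI _] := hG.
have [fU rU] := modular_rank mI flX flY' fX fY'.
rewrite rY' in rU.
(* Otherwise X `|` e Y would lie in cl X = X, against the choice of e. *)
have ltXU : (rk I X < rk I (X `|` translate e Y))%N.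
  rewrite ltnNge; apply/negP => /(sub_cl_of_rank fmI fU (@subsetUl _ _ _)).
  by rewrite flX => UX; apply: nXey; apply: UX; right; exists y.
(* Z = Y `&` e^-1 X is studied through e Z = X `&` e Y, the intersection to
   which modularity applies. *)
pose Z := Y `&` translate e^-1 X.
have eZ : translate e Z = X `&` translate e Y.
  rewrite setIC; apply/seteqP; split=> [_ [z [Yz Xz] <-]|_ [[z Yz <-] Xez]].
    by rewrite /setI/= translateE -(translateVK e X) translateE.
  by rewrite translateE; split=> //; rewrite -(translateE e) translateVK.
have flZ : flat I Z by apply: flat_setI flY (flat_translate hI e^-1 flX).
have [fZ _] := sub_rank fmI fY (@subIsetl _ Y (translate e^-1 X)).
have [_ rZ] := rank_translate hI e fZ.
have Z1 : Z 1 by split=> //; exists e => //; exact: mulVg.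
have [fcU rcU] := cl_rank fmI fU.
have [|S [N [[flS fS US] [N1 SNcl SNS rSN]]]] :=
  IH _ Z (cl_flat fmI fU) flZ fcU fZ Z1.
  move: rU ltXU ltYn; rewrite -eZ rZ.
  move: (rk I X) (rk I Y) (rk I Z) (rk I (_ `|` _)) => a b c d.
  by lia.
exists S, N; split; split=> //.
- by apply: subset_trans US => x Xx; left; left.
- apply: (subset_trans SNcl).
  apply: (cl_sub_flat (cl_flat fmI (finite_rank_prod fX fY))).
  apply: subset_trans (@set_prod_cll _ _) _; apply: cl_mono.
  move=> _ [v [Xv|[u Yu <-]] [z [Yz [x Xx xz]] <-]].
    by exists v => //; exists z.
  exists x => //; exists u => //.
  by rewrite -xz mulgA [e * u]mulgC mulgK mulgC.
- by rewrite rSN rcU rU -eZ rZ.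
Qed.

End AbelianProduct.

(** * The submonoid-rank threshold *)

Section Threshold.
Context {G : groupType} {I : set (set G)}.
Local Open Scope ereal_scope.

(** The finite values in the threshold set are natural numbers, so the set has
    a minimum, and [mu] is that minimum. *)
Lemma mu_lbound : lbound (threshold_set I) (mu I).
Proof.
suff ex : exists m, (threshold_set I `&` lbound (threshold_set I)) m.
  by have [] := xgetPex +oo ex.
pose P n := `[< exists2 H, submonoid H /\ 1 < rank I H < +oo &
                           rank I H = (n%:Z)%:E >].
have rankP (H : set G) : submonoid H /\ 1 < rank I H < +oo ->
    rank I H = ((rk I H)%:Z)%:E.
  move=> [_ /andP[_]]; have [/rankE //|nfH] := pselect (finite_rank I H).
  by rewrite /rank asboolF.
have [exP|noP] := pselect (exists n, P n); last first.
  exists +oo; split; first by right.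
  move=> _ [[H Hth <-]|->//]; exfalso; apply: noP; exists (rk I H).
  by apply/asboolP; exists H => //; exact: rankP.
have [n /asboolP[H Hth rH] nmin] := ex_minnP exP.
exists (n%:Z)%:E; split; first by left; exists H.
move=> _ [[K Kth <-]|->]; last exact: leey.
rewrite (rankP _ Kth) lee_fin lez_nat; apply: nmin; apply/asboolP.
by exists K => //; exact: rankP.
Qed.

End Threshold.

(** * The theorem *)

Local Open Scope ereal_scope.

Theorem theorem7p14 (G : groupType) (I : set (set G))
  (hG : modular_abelian_independence_group I) (X Y : set G)
  (hX0 : X !=set0) (hY0 : Y !=set0)
  (hX : finite_rank I X) (hY : finite_rank I Y) :
  mine (mu I) (rank I X + rank I Y - 1) <= rank I (set_prod X Y)
  /\
  exists S M : set G,
    [/\ S !=set0, flat I S & S `<=` cl I (set_prod X Y)] /\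
    [/\ submonoid M, flat I M & finite_rank I M] /\
    set_prod S M = S /\
    [/\ rank I X + rank I Y - rank I S <= rank I M,
        rank I M <= rank I S
      & rank I S <= rank I (set_prod X Y)] /\
    (rank I (set_prod X Y) < rank I X + rank I Y - 1 -> 1 < rank I M).
Proof.
have [hI _ mulC] := hG; have fmI := hI.1.
have fXY := finite_rank_prod hG hX hY.
have [y Yy] := hY0; have [x Xx] := hX0.
(* Moving to (y X, y^-1 Y) puts 1 in the second set. *)
have prodE : set_prod (translate y X) (translate y^-1%g Y) = set_prod X Y.
  apply/seteqP; split=> [_ [_ [u Uu <-] [_ [v Yv <-] <-]]|_ [u Xu [v Yv <-]]].
    by exists u => //; exists v => //; rewrite (mulC y u) mulgA mulgK.
  exists (y * u)%g; first by exists u.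
  exists (y^-1 * v)%g; first by exists v.
  by rewrite (mulC y u) mulgA mulgK.
have [fyX ryX] := rank_translate hI y hX.
have [fyY ryY] := rank_translate hI y^-1%g hY.
have [fcX rcX] := cl_rank fmI fyX; have [fcY rcY] := cl_rank fmI fyY.
have Y1 : cl I (translate y^-1%g Y) 1%g.
  by left; exists y => //; exact: mulVg.
have [S [N [[flS fS XS] [N1 SNcl SNS rSN]]]] :=
  dyson_saturation hG (cl_flat fmI fyX) (cl_flat fmI fyY) fcX fcY Y1
    (ltnSn _).
have S0 : S !=set0 by exists (y * x)%g; apply: XS; left; exists x.
have [fM rMS] := stabilizer_rank hI S0 fS.
have NM : N `<=` stabilizer S.
  by move=> g Ng s Ss; apply: SNS; exists s => //; exists g.
have [_ rNM] := sub_rank fmI fM NM.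
have clXY : set_prod (cl I (translate y X)) (cl I (translate y^-1%g Y)) `<=`
    cl I (set_prod X Y).
  by rewrite -prodE; apply: set_prod_cl; rewrite ?prodE.
have ScXY : S `<=` cl I (set_prod X Y).
  move=> s Ss; apply: (cl_sub_flat (cl_flat fmI fXY) clXY); apply: SNcl.
  by exists s => //; exists 1%g => //; rewrite mulg1.
have [fcXY rcXY] := cl_rank fmI fXY.
have [_ rS] := sub_rank fmI fcXY ScXY.
rewrite rcXY in rS; rewrite rcX rcY ryX ryY in rSN.
have leM : (rank I X + rank I Y - rank I S <= rank I (stabilizer S)).
  by rewrite !rankE// -EFinN -!EFinD lee_fin; lia.
have leMS : (rank I (stabilizer S) <= rank I S).
  by rewrite !rankE// lee_fin lez_nat.
have leS : (rank I S <= rank I (set_prod X Y)).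
  by rewrite !rankE// lee_fin lez_nat.
have ltM : (rank I (set_prod X Y) < rank I X + rank I Y - 1 ->
    1 < rank I (stabilizer S)).
  by rewrite !rankE// -EFinN -!EFinD !lte_fin; lia.
split; last first.
  exists S, (stabilizer S); split; first by split.
  split; first split=> //.
  - exact: stabilizer_submonoid.
  - exact: stabilizer_flat.
  by split; first exact: set_prod_stabilizer.
rewrite ge_min; have [_|/ltM ltM1] := leP (rank I X + rank I Y - 1) _.
  by rewrite orbT.
apply/orP; left; apply: le_trans leS; apply: le_trans leMS.
apply: mu_lbound; left; exists (stabilizer S) => //; split.
  exact: stabilizer_submonoid.
by rewrite ltM1 rankE// ltry.
Qed.
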